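(* Let $k\in\mathbb{N}$, $m=3^k$, let $T:[0,1]\to[0,1]$, $T(x)=mx\bmod 1$, let $\mu$ be Lebesgue measure on $[0,1]$, and let $\varphi$ be the Cantor ladder function of the ternary Cantor set. Put $X_j=\varphi\circ T^j$ for $j\ge0$ and $M_N=\max\{X_0,\dots,X_{N-1}\}$. Let $\tau\ge0$, and for $n\in\mathbb{N}$ let $u_n=n+k-1$ and $w_n=\lfloor\tau(3/2)^{n+k-1}\rfloor$. Then $w_n\,\mu(X_0>u_n)\to\tau$ as $n\to\infty$, and moreover $$\lim_{n\to\infty}\mu(M_{w_n}\le u_n)=e^{-\left(1-\frac{2^k}{3^k}\right)\tau}.$$
   Context: $\mathbb{N}=\{1,2,3,\dots\}$. Ternary Cantor set: $\mathcal{C}_0=[0,1]$, and for $n\ge 1$, $\mathcal{C}_n$ is obtained from $\mathcal{C}_{n-1}$ by removing the open middle third of each connected component of $\mathcal{C}_{n-1}$; $\mathcal{C}=\bigcap_{n\ge1}\mathcal{C}_n$. For $n\ge1$ let $B_n=\mathcal{C}_{n-1}\setminus\mathcal{C}_n$. The Cantor ladder function is $\varphi:[0,1]\to\mathbb{N}\cup\{\infty\}$ with $\varphi(x)=n$ if $x\in B_n$ ($n=1,2,3,\dots$) and $\varphi(x)=\infty$ otherwise (i.e. for $x\in\mathcal{C}$). The event $\{M_0\le u\}$ (maximum over an empty set) is understood to be the whole space. *)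

(* Defs.v *)
From HB Require Import structures.
From mathcomp Require Import all_boot all_order all_algebra.
From mathcomp Require Import all_classical all_reals all_analysis.
Set Implicit Arguments.
Unset Strict Implicit.
Unset Printing Implicit Defensive.
Import Order.TTheory GRing.Theory Num.Theory.
Import numFieldNormedType.Exports.
Local Open Scope classical_set_scope.
Local Open Scope ring_scope.

(* Maps on [0, 1] are represented by total functions on R; their values outside
   [0, 1] are irrelevant, since [mult_mod1 m] maps [0, 1] into itself and all
   measures are taken with respect to [leb01]. *)

Definition middle_third {R : realType} (I : set R) : set R :=
  `](inf I + (sup I - inf I) / 3), (sup I - (sup I - inf I) / 3)[%classic.

Definition remove_middle_thirds {R : realType} (A : set R) : set R :=
  A `\` \bigcup_(x in A) middle_third (connected_component A x).

Fixpoint cantor_stage {R : realType} (n : nat) : set R :=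
  if n is n'.+1 then remove_middle_thirds (cantor_stage n')
  else `[0, 1]%classic.

Lemma cantor_stage_anti (R : realType) (i j : nat) :
  (i <= j)%N -> cantor_stage j `<=` (cantor_stage i : set R).
Proof.
move=> /subnK <-; elim: (j - i)%N => [//|n IH] x.
by rewrite addSn => -[/IH].
Qed.

Definition ternary_cantor_set {R : realType} : set R :=
  \bigcap_(n in [set n | (1 <= n)%N]) cantor_stage n.

(* Used for n >= 1 only. *)
Definition cantor_gap {R : realType} (n : nat) : set R :=
  cantor_stage n.-1 `\` cantor_stage n.

(* The gaps are pairwise disjoint, so the index chosen by [cid] is the only
   possible one: see [cantor_ladder_gap] and [cantor_ladder_cantor]. *)
Definition cantor_ladder {R : realType} (x : R) : \bar R :=
  match pselect (exists n : nat, (1 <= n)%N /\ cantor_gap n x) with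
  | left gap_x => (sval (cid gap_x))%:R%:E
  | right _ => +oo%E
  end.

Lemma cantor_gap_inj (R : realType) (i j : nat) (x : R) :
  (1 <= i)%N -> (1 <= j)%N -> cantor_gap i x -> cantor_gap j x -> i = j.
Proof.
case: i => // i; case: j => // j _ _ [xi nxi] [xj nxj].
case: (ltngtP i j) => [ij|ji|->//].
- by case: nxi; apply: (cantor_stage_anti ij).
- by case: nxj; apply: (cantor_stage_anti ji).
Qed.

Lemma cantor_ladder_gap (R : realType) (n : nat) (x : R) :
  (1 <= n)%N -> cantor_gap n x -> cantor_ladder x = n%:R%:E.
Proof.
move=> n1 gx; rewrite /cantor_ladder; case: pselect => [e|]; last first.
  by case; exists n.
by case: cid => i /= [i1 gi]; rewrite (cantor_gap_inj i1 n1 gi gx).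
Qed.

Lemma cantor_ladder_cantor (R : realType) (x : R) :
  `[0, 1]%classic x -> cantor_ladder x = +oo%E <-> ternary_cantor_set x.
Proof.
move=> x01; rewrite /cantor_ladder; case: pselect => [e|ne]; split => //.
- case: cid => n /= [n1 [_ nx]] xC; exfalso; exact: nx (xC n n1).
- move=> _ n _; elim: n => [//|n IH].
  by apply: contrapT => nx; apply: ne; exists n.+1.
Qed.

Definition mult_mod1 {R : realType} (m : nat) (x : R) : R :=
  m%:R * x - (Num.floor (m%:R * x))%:~R.

(* The empty maximum is -oo, so that [set x | partial_max X 0 x <= u] is the
   whole space for every u. *)
Definition partial_max {R : realType} (X : nat -> R -> \bar R) (N : nat)
    (x : R) : \bar R :=
  (\big[maxe/-oo]_(j < N) X j x)%E.

Definition leb01 {R : realType} : set R -> \bar R :=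
  mrestr (@lebesgue_measure R)
    (measurable_itv `[0, 1] : measurable (`[0, 1]%classic : set R)).

(* Main.v *)
Require Import Defs.
From HB Require Import structures.
From mathcomp Require Import all_boot all_order all_algebra.
From mathcomp Require Import all_classical all_reals all_analysis.
From mathcomp Require Import measurable_realfun ring lra zify.
Set Implicit Arguments.
Unset Strict Implicit.
Unset Printing Implicit Defensive.
Import Order.TTheory GRing.Theory Num.Theory.
Import numFieldNormedType.Exports.
Local Open Scope classical_set_scope.
Local Open Scope ring_scope.

(** Off the countable set of triadic rationals, a point of the unit interval
lies in the [u]-th Cantor stage exactly when none of its first [u] ternary
digits is [1], and the map [x |-> 3 ^ k x mod 1] deletes the first [k] digits.
Under Lebesgue measure the digits are independent and uniform, so the event
[M_w <= u] says that, in a sequence of independent trials of success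
probability [q = 2 / 3], no run of [u] successes starts at any of the times
[0, k, ..., (w - 1) k].

Write [delta = q ^ u], [eps = delta (1 - q ^ k)], and let [p_N] be the
probability that no such run starts at the first [N] of these times.  By
invariance [p_N] is also the probability that none starts at the times
[k, ..., N k], so [p_N - p_(N+1)] is the probability that, in addition, a run
starts at time [0].  For [N > 0], after a run at time [0], the absence of a run
at time [k] forces a failure among the trials [u, ..., u + k - 1].  A run at
time [0] with such a failure is an event [stop] of probability [eps],
independent of what happens from time [(u + 1) k] on.  On [stop], a run
starting at a time [i k] with [0 < i <= u] is impossible when [i k <= u], as it
would contain the failure; otherwise it lies beyond the run at time [0], so it
costs at most [delta ^ 2].  Hence [p_(N+1)] is [(1 - eps) p_N] up to
[u delta ^ 2], and by induction [p_N = (1 - eps) ^ N] up to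
[delta + N u delta ^ 2] ([probability_run_free]).
The factor [1 - q ^ k] in [eps], the extremal index, accounts for the
clustering of overlapping runs.

With [w] the integer part of [tau / delta], the product [w delta] tends to
[tau], the error is at most [delta + tau u delta], which tends to [0], and
[(1 - eps) ^ w] tends to [exp (- (1 - q ^ k) tau)] ([cvg_onem_expn]).

The remaining work relates the Cantor stages, defined through connected
components, to ternary digits: [cantor_stageP] describes the [n]-th stage as
the union of the intervals [[a / 3 ^ n, (a + 1) / 3 ^ n]] where [a] has at
most [n] ternary digits, none of them [1].  Two consecutive integers are never both of this kind, so
these intervals are the components of the stage. *)

(** * Runs in a sequence of independent trials *)

(** [S] is a measure-preserving map and [H] an event of probability [q] that is
    independent of all that happens from time [1] on, so that the occurrences of
    [H] at the successive times are independent trials of success probability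
    [q]. *)
Section runs.
Context d (Y : measurableType d) (R : realType) (P : probability Y R).
Variables (S : Y -> Y) (H : set Y) (q : R).
Hypothesis mS : measurable_fun setT S.
Hypothesis mH : measurable H.
Hypothesis PS : forall B, measurable B -> P (S @^-1` B) = P B.
Hypothesis PH : forall B, measurable B -> P (H `&` S @^-1` B) = (q%:E * P B)%E.

Let p (A : set Y) : R := fine (P A).

Let pE A : measurable A -> P A = (p A)%:E.
Proof. by move=> mA; rewrite /p fineK// fin_num_measure. Qed.

Let p_ge0 A : 0 <= p A. Proof. by rewrite /p fine_ge0. Qed.

Let le_p A B : measurable A -> measurable B -> A `<=` B -> p A <= p B.
Proof.
by move=> mA mB AB; rewrite -lee_fin -!pE// le_measure// inE.
Qed.

Let pDI A B : measurable A -> measurable B -> p (A `\` B) = p A - p (A `&` B).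
Proof.
move=> mA mB; apply: EFin_inj; rewrite EFinB -!pE//; last exact: measurableD.
- by rewrite measureD// -ge0_fin_numE// fin_num_measure.
- exact: measurableI.
Qed.

Let p_setT : p setT = 1. Proof. by rewrite /p probability_setT. Qed.

Lemma measurable_iter n : measurable_fun setT (iter n S).
Proof.
elim: n => [|n IH]; first exact: measurable_id.
rewrite [X in measurable_fun _ X](_ : _ = S \o iter n S)//.
exact: measurableT_comp.
Qed.

Lemma measurable_iter_preimage n B :
  measurable B -> measurable (iter n S @^-1` B).
Proof.
by move=> mB; rewrite -[X in measurable X]setTI; exact: measurable_iter.
Qed.

Let p_iter n B : measurable B -> p (iter n S @^-1` B) = p B.
Proof.
move=> mB; rewrite /p; congr fine; elim: n => [//|n IH].
rewrite -IH -[RHS]PS; last exact: measurable_iter_preimage.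
by congr (P _); apply/funext => x; rewrite /preimage /= -iterSr.
Qed.

(** [run u] is the event that [H] occurs at the times [0, ..., u - 1]. *)
Definition run u : set Y := [set x | forall i, (i < u)%N -> H (iter i S x)].

Lemma runS u : run u.+1 = H `&` S @^-1` run u.
Proof.
apply/seteqP; split=> x /=.
  by move=> h; split=> [|i iu]; [exact: (h 0%N)|rewrite -iterSr; exact: h].
by move=> [h0 h] [//|i] iu; rewrite iterSr; exact: h.
Qed.

Lemma measurable_run u : measurable (run u).
Proof.
elim: u => [|u IH].
  by rewrite (_ : run 0 = setT)//; apply/seteqP; split.
by rewrite runS; apply: measurableI => //; exact: (measurable_iter_preimage 1).
Qed.

Lemma runD u v : run (u + v) = run u `&` iter u S @^-1` run v.
Proof.
apply/seteqP; split=> x /=.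
  move=> h; split=> i iu; first by apply: h; lia.
  by rewrite -iterD; apply: h; lia.
move=> [hu hv] i iuv; have [iu|ui] := ltnP i u; first exact: hu.
by rewrite -(subnK ui) iterD; apply: hv; lia.
Qed.

(** A run of length [u] at time [0] is independent of the trials from time [u]
    on. *)
Let p_runI u B : measurable B ->
  p (run u `&` iter u S @^-1` B) = q ^+ u * p B.
Proof.
move=> mB; elim: u => [|u IH].
  by rewrite expr0 mul1r; congr p; apply/seteqP; split=> [x []//|x].
rewrite exprS -mulrA -IH; apply: EFin_inj; rewrite EFinM -!pE.
- rewrite -PH; last first.
    by apply: measurableI; [exact: measurable_run|exact: measurable_iter_preimage].
  congr (P _); rewrite runS -setIA; congr (_ `&` _).
  by apply/seteqP; split=> x /=; rewrite -iterSr.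
- by apply: measurableI; [exact: measurable_run|exact: measurable_iter_preimage].
- by apply: measurableI; [exact: measurable_run|exact: measurable_iter_preimage].
Qed.

Lemma probability_run u : P (run u) = (q ^+ u)%:E.
Proof.
rewrite pE; last exact: measurable_run.
by rewrite -[q ^+ u]mulr1 -p_setT -p_runI// preimage_setT setIT.
Qed.

Let p_run u : p (run u) = q ^+ u.
Proof. by rewrite /p probability_run. Qed.

Let q_ge0 : 0 <= q. Proof. by rewrite -[q]expr1 -p_run. Qed.
Let q_le1 : q <= 1.
Proof. by rewrite -[q]expr1 -p_run -p_setT le_p//; exact: measurable_run. Qed.

Variables (k u : nat).
Hypothesis k_gt0 : (0 < k)%N.

(** [run_free N] is the event that no run of length [u] starts at any of the
    times [0, k, ..., (N - 1) k]. *)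
Definition run_free N : set Y :=
  [set x | forall j, (j < N)%N -> ~ run u (iter (j * k) S x)].

Lemma run_freeS N : run_free N.+1 = iter k S @^-1` run_free N `\` run u.
Proof.
apply/seteqP; split=> x /=.
  move=> h; split=> [j jN|]; last exact: (h 0%N).
  by rewrite -iterD -mulSnr; exact: h.
by move=> [h h0] [//|j] jN; rewrite mulSnr iterD; exact: h.
Qed.

Lemma measurable_run_free N : measurable (run_free N).
Proof.
elim: N => [|N IH].
  by rewrite (_ : run_free 0 = setT)//; apply/seteqP; split.
rewrite run_freeS; apply: measurableD; last exact: measurable_run.
exact: measurable_iter_preimage.
Qed.

Let delta : R := q ^+ u.
(* the probability of [stop] below *)
Let eps : R := delta * (1 - q ^+ k).
Let p_free N := p (run_free N).

Let p_freeS N :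
  p_free N.+1 = p_free N - p (iter k S @^-1` run_free N `&` run u).
Proof.
rewrite /p_free run_freeS pDI ?p_iter//; try exact: measurable_run_free.
  exact/measurable_iter_preimage/measurable_run_free.
exact: measurable_run.
Qed.

Let p_free_bound a b :
  p_free (a + b) <= p_free a <= p_free (a + b) + b%:R * delta.
Proof.
elim: b => [|b /andP[IH1 IH2]]; first by rewrite addn0 mul0r addr0 lexx.
rewrite addnS p_freeS; set l := p (_ `&` _).
have l0 : 0 <= l by exact: p_ge0.
have l1 : l <= delta.
  rewrite /delta -p_run; apply: le_p; [|exact: measurable_run|exact: subIsetr].
  apply: measurableI; last exact: measurable_run.
  exact/measurable_iter_preimage/measurable_run_free.
rewrite -natr1; apply/andP; split; [lra|].
by rewrite mulrDl mul1r; lra.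
Qed.

(** A run of at least [u], but fewer than [u + k], successes starts at time
    [0]. *)
Let stop := run u `\` run (u + k).

Let m_stop : measurable stop.
Proof. by apply: measurableD; exact: measurable_run. Qed.

Let p_stopI n B : (u + k <= n)%N -> measurable B ->
  p (stop `&` iter n S @^-1` B) = eps * p B.
Proof.
move=> ukn mB; set C := iter n S @^-1` B.
have mC : measurable C by exact: measurable_iter_preimage.
have E v : (v <= n)%N -> p (run v `&` C) = q ^+ v * p B.
  move=> vn; rewrite -(p_iter (n - v) mB) -p_runI.
    by congr (p (_ `&` _)); apply/seteqP; split=> x /=; rewrite -iterD subnK.
  exact: measurable_iter_preimage.
have -> : stop `&` C = (run u `&` C) `\` run (u + k).
  by rewrite /stop; apply/seteqP; split=> x /=; tauto.
rewrite pDI; [|by apply: measurableI => //; exact: measurable_run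
              |exact: measurable_run].
have -> : run u `&` C `&` run (u + k) = run (u + k) `&` C.
  by rewrite runD; apply/seteqP; split=> x /=; tauto.
by rewrite !E//; [rewrite exprD /eps /delta; ring|lia].
Qed.

Let delta_ge0 : 0 <= delta. Proof. exact: exprn_ge0. Qed.
Let delta_le1 : delta <= 1. Proof. by rewrite exprn_ile1. Qed.
Let eps_ge0 : 0 <= eps.
Proof. by rewrite mulr_ge0// subr_ge0 exprn_ile1. Qed.
Let eps_le_delta : eps <= delta.
Proof. by rewrite ler_piMr// gerBl exprn_ge0. Qed.

(** A further run at time [i k] would contain the failure that ends the first
    run, or is independent of the first [u] trials. *)
Let p_stop_run i : (0 < i)%N ->
  p (stop `&` iter (i * k) S @^-1` run u) <= delta ^+ 2.
Proof.
move=> i0; have mr v w : measurable (run v `&` iter w S @^-1` run u).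
  by apply: measurableI; [|apply: measurable_iter_preimage]; exact: measurable_run.
have ms : measurable (stop `&` iter (i * k) S @^-1` run u).
  by apply: measurableI => //; apply: measurable_iter_preimage; exact: measurable_run.
have [iku|uik] := leqP (i * k) u.
  rewrite (_ : _ `&` _ = set0); first by rewrite /p measure0 sqr_ge0.
  apply/seteqP; split=> // x [[ru nr] ru']; apply: nr.
  move=> j juk; have [ju|uj] := ltnP j u; first exact: ru.
  have jik : (i * k <= j)%N by lia.
  by rewrite -(subnK jik) iterD; apply: ru'; nia.
rewrite expr2 /delta -{2}(p_run u) -(p_iter (i * k - u) (measurable_run u)).
rewrite -p_runI; last by apply: measurable_iter_preimage; exact: measurable_run.
have -> : run u `&` iter u S @^-1` (iter (i * k - u) S @^-1` run u) =
          run u `&` iter (i * k) S @^-1` run u.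
  by apply/seteqP; split=> x /=; rewrite -iterD subnK// ltnW.
by apply: le_p => //; apply: setSI; exact: subDsetl.
Qed.

(** [stop] occurs and no run starts at the times [i k, ..., N k].  For [i]
    beyond [N] the truncated subtraction makes the second condition void. *)
Let stop_free N i := stop `&` iter (i * k) S @^-1` run_free (N.+1 - i).

Let m_stop_free N i : measurable (stop_free N i).
Proof. exact/measurableI/measurable_iter_preimage/measurable_run_free. Qed.

Let p_stop_free_step N i : (0 < i)%N ->
  p (stop_free N i.+1) - delta ^+ 2 <= p (stop_free N i) <= p (stop_free N i.+1).
Proof.
move=> i0; have [iN|Ni] := leqP i N; last first.
  have -> : stop_free N i.+1 = stop_free N i.
    have e0 : (N.+1 - i = 0)%N by lia.
    have e1 : (N.+1 - i.+1 = 0)%N by lia.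
    by rewrite /stop_free e0 e1; apply/seteqP; split=> x [? _]; split.
  by rewrite lexx gerBl sqr_ge0.
pose C := iter (i * k) S @^-1` run u.
have mC : measurable C by apply: measurable_iter_preimage; exact: measurable_run.
have -> : stop_free N i = stop_free N i.+1 `\` C.
  rewrite /stop_free /C (_ : (N.+1 - i)%N = (N.+1 - i.+1).+1); last by lia.
  rewrite run_freeS mulSn; apply/seteqP; split=> x /=.
    by rewrite -iterD; tauto.
  by rewrite iterD; tauto.
have := p_stop_run i0; rewrite -/C => pC.
have : p (stop_free N i.+1 `&` C) <= p (stop `&` C).
  apply: le_p; [exact: measurableI|exact: measurableI|].
  by apply: setSI; exact: subIsetl.
rewrite pDI//; have := p_ge0 (stop_free N i.+1 `&` C); lra.
Qed.

Let p_stop_free N i :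
  p (stop_free N i.+1) - i%:R * delta ^+ 2 <= p (stop_free N 1)
    <= p (stop_free N i.+1).
Proof.
elim: i => [|i /andP[IH1 IH2]]; first by rewrite mul0r subr0 lexx.
have /andP[h1 h2] := p_stop_free_step N (ltn0Sn i).
rewrite -natr1 mulrDl mul1r; apply/andP; split; lra.
Qed.

(** Once the time [k] is among those where no run starts, a run at time [0] is
    the same as [stop]. *)
Let p_free_step N : (0 < N)%N ->
  `|p_free N.+1 - (1 - eps) * p_free N| <= u%:R * delta ^+ 2.
Proof.
move=> N0; rewrite p_freeS.
have -> : iter k S @^-1` run_free N `&` run u = stop_free N 1.
  rewrite /stop_free /stop mul1n subn1/=; apply/seteqP; split=> x /=; last tauto.
  move=> [h ru]; split=> //; split=> //; rewrite runD => -[_ ru'].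
  apply: (h 0%N) => //= i iu; rewrite -iterD addnC.
  have [/ru|ui] := ltnP (i + k) u; first by rewrite addnC.
  rewrite addnC -(subnK ui) iterD; apply: ru'; lia.
have /andP[] := p_stop_free N u.
rewrite /stop_free p_stopI; [|nia|exact: measurable_run_free].
rewrite subSS; set l := p (_ `&` _); rewrite -/(p_free _) => h1 h2.
have h3 : p_free N <= p_free (N - u) <= p_free N + u%:R * delta.
  have := p_free_bound (N - u) (N - (N - u)).
  rewrite (_ : (N - u + (N - (N - u)) = N)%N); last by lia.
  move=> /andP[-> h] /=; apply: (le_trans h); rewrite lerD2l ler_wpM2r// ler_nat.
  lia.
case/andP: h3 => h3 h4.
have h5 : eps * p_free N <= eps * p_free (N - u) by exact: ler_wpM2l.
have h6 : eps * p_free (N - u) <= eps * (p_free N + u%:R * delta).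
  by exact: ler_wpM2l.
have h7 : eps * (u%:R * delta) <= delta * (u%:R * delta).
  by rewrite ler_wpM2r// mulr_ge0.
by rewrite ler_norml; apply/andP; split; nra.
Qed.

(** The summand [q ^+ u] is the error made in the first step, from [N = 0] to
    [N = 1]; each of the others costs [u * (q ^+ u) ^+ 2]. *)
Lemma probability_run_free N :
  `|fine (P (run_free N)) - (1 - q ^+ u * (1 - q ^+ k)) ^+ N|
    <= q ^+ u + N%:R * (u%:R * (q ^+ u) ^+ 2).
Proof.
rewrite -/(p _) -/delta -/eps -/(p_free N).
have f0 : p_free 0 = 1.
  by rewrite -p_setT /p_free; congr p; apply/seteqP; split.
case: N => [|N]; first by rewrite f0 expr0 subrr normr0 mul0r addr0.
elim: N => [|N IH].
  rewrite p_freeS f0 expr1 (_ : _ `&` _ = run u); last first.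
    by apply/seteqP; split=> [x []//|x ru]; split.
  have := eps_ge0; have := eps_le_delta; rewrite p_run -/delta ler_norml mul1r.
  have : 0 <= u%:R * delta ^+ 2 by rewrite mulr_ge0// sqr_ge0.
  by move=> *; apply/andP; split; lra.
have hs := p_free_step (ltn0Sn N).
set a := p_free N.+2 in hs *; set b := p_free N.+1 in IH hs.
rewrite exprS [X in `|X|](_ : _ = (a - (1 - eps) * b) +
  (1 - eps) * (b - (1 - eps) ^+ N.+1)); last by ring.
apply: (le_trans (ler_normD _ _)).
rewrite normrM.
have : `|1 - eps| * `|b - (1 - eps) ^+ N.+1| <= `|b - (1 - eps) ^+ N.+1|.
  rewrite ler_piMl// ler_norml; have := eps_ge0; have := eps_le_delta.
  by have := delta_le1 => *; apply/andP; split; lra.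
  lra.
Qed.

End runs.

(** * The ternary shift preserves Lebesgue measure and has independent digits *)

(** [leb01], typed on the Borel space that carries [lebesgue_measure], so that
    it can be given the structure of a probability. *)
Definition unit_lebesgue (R : realType) : set (measurableTypeR R) -> \bar R :=
  @leb01 R.

HB.instance Definition _ (R : realType) := Measure.copy (@unit_lebesgue R)
  (mrestr (@lebesgue_measure R)
    (measurable_itv `[0, 1] : measurable (`[0, 1]%classic : set R))).

Lemma unit_lebesgue_setT (R : realType) : @unit_lebesgue R setT = 1%E.
Proof.
rewrite /unit_lebesgue /leb01 /mrestr setTI lebesgue_measure_itv/=.
by rewrite lte01 oppr0 adde0.
Qed.

HB.instance Definition _ (R : realType) :=
  Measure_isProbability.Build _ _ R (@unit_lebesgue R) (@unit_lebesgue_setT R).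

Lemma unit_lebesgueE (R : realType) (A : set (measurableTypeR R)) :
  measurable A ->
  unit_lebesgue A = lebesgue_measure (A `&` `[0, 1[%classic).
Proof.
move=> mA; rewrite /unit_lebesgue /leb01 /mrestr.
have -> : A `&` `[0, 1]%classic = (A `&` `[0, 1[%classic) `|` (A `&` [set 1]).
  by rewrite -setIUr setUitv1 ?bnd_simp//.
rewrite measureU0//.
- by apply: measurableI => //; exact: measurable_itv.
- exact: measurableI.
- apply: countable_lebesgue_measure0; apply: (@sub_countable _ _ _ [set (1 : R)]).
    by apply: subset_card_le; exact: subIsetr.
  exact: countable1.
Qed.

Lemma measurable_mult_mod1 (R : realType) m :
  measurable_fun [set: measurableTypeR R]
    (@mult_mod1 R m : _ -> measurableTypeR R).
Proof.
apply: measurable_funB; first exact: measurable_funM.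
apply: nondecreasing_measurable => // x y xy.
by rewrite ler_int le_floor// ler_wpM2l.
Qed.

Lemma lebesgue_measure_affine (R : realType) (a b : R)
    (A : set (measurableTypeR R)) : 0 < a -> measurable A ->
  lebesgue_measure ((fun x => a * x + b) @^-1` A) =
    (a^-1%:E * lebesgue_measure A)%E.
Proof.
move=> a0 mA.
pose f : measurableTypeR R -> measurableTypeR R := fun x => a * x + b.
have mf : measurable_fun setT f.
  by apply: measurable_funD => //; exact: measurable_funM.
pose nu : {measure set (measurableTypeR R) -> \bar R} :=
  mscale (NngNum (ltW a0)) (pushforward (@lebesgue_measure R) f).
rewrite (@lebesgue_measure_unique _ (nu mf) _ A mA).
  by rewrite /nu/= /mscale/= muleA -EFinM mulVf ?gt_eqF// mul1e.
move=> _ [[x y]] _ <-; rewrite /nu/= /mscale/= /pushforward.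
have -> : f @^-1` `]x, y]%classic = `]((x - b) / a), ((y - b) / a)]%classic.
  apply/seteqP; split=> z /=;
    by rewrite !in_itv/= ltr_pdivrMr// ler_pdivlMr// /f ltrBlDr lerBrDr
      ![a * z]mulrC.
rewrite !lebesgue_measure_itv/= !lte_fin ltr_pM2r ?invr_gt0// ltrD2r.
case: ifPn => xy; last by rewrite mule0.
by rewrite -!EFinB -EFinM; congr EFin; field; rewrite gt_eqF.
Qed.

(** The points of the unit interval whose first ternary digit is not [1]; the
    definition is irrelevant elsewhere. *)
Definition digit_not1 (R : realType) : set (measurableTypeR R) :=
  [set x | ~ (1 <= 3 * x < 2)].

Lemma measurable_digit_not1 (R : realType) : measurable (@digit_not1 R).
Proof.
have -> : @digit_not1 R = ~` `[3^-1, 2 / 3[%classic.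
  apply/seteqP; split=> x /=; rewrite /digit_not1 in_itv/= => h /andP[h1 h2];
    by apply: h; apply/andP; split; lra.
by apply: measurableC; exact: measurable_itv.
Qed.

Section ternary_shift.
Context (R : realType).
Notation S := (@mult_mod1 R 3 : measurableTypeR R -> measurableTypeR R).
Notation mu := (@unit_lebesgue R).

(** The points with first ternary digit [d], when [d < 3]. *)
Let cell (d : nat) : set (measurableTypeR R) :=
  `[(d%:R / 3 : R), (d.+1%:R / 3)[%classic.

Let lebesgue_cell (d : nat) (B : set (measurableTypeR R)) : measurable B ->
  lebesgue_measure (S @^-1` B `&` cell d) = ((3^-1)%:E * mu B)%E.
Proof.
move=> mB; rewrite unit_lebesgueE// -(@lebesgue_measure_affine _ 3 (- d%:R))//;
  last first.
  by apply: measurableI => //; exact: measurable_itv.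
congr (lebesgue_measure _); rewrite -[in RHS]/(_ @^-1` _).
have key (x : R) : d%:R / 3 <= x < d.+1%:R / 3 -> mult_mod1 3 x = 3 * x - d%:R.
  move=> /andP[h1 h2]; rewrite /mult_mod1 (@floor_def _ _ (d%:Z))//.
  rewrite -[d.+1%:R]natr1 in h2; rewrite intrD -!pmulrn.
  by apply/andP; split; lra.
apply/seteqP; split=> x /=.
  rewrite /cell /= !in_itv/= => -[Bx dx]; rewrite -(key _ dx); split=> //.
  rewrite (key _ dx); move: dx; rewrite -[d.+1%:R]natr1 => /andP[? ?].
  by apply/andP; split; lra.
rewrite /cell /= !in_itv/= => -[Bx dx].
have dx' : d%:R / 3 <= x < d.+1%:R / 3.
  by move: dx; rewrite -[d.+1%:R]natr1 => /andP[? ?]; apply/andP; split; lra.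
by rewrite (key _ dx').
Qed.

Let m_cell d : measurable (cell d). Proof. exact: measurable_itv. Qed.

Let m_preimage (B : set (measurableTypeR R)) :
  measurable B -> measurable (S @^-1` B).
Proof.
by move=> mB; rewrite -[X in measurable X]setTI; exact: measurable_mult_mod1.
Qed.

Lemma unit_lebesgue_shift_digit (B : set (measurableTypeR R)) : measurable B ->
  mu (@digit_not1 R `&` S @^-1` B) = ((2 / 3)%:E * mu B)%E.
Proof.
move=> mB; have mSB := m_preimage mB.
rewrite unit_lebesgueE; last by apply: measurableI => //; exact: measurable_digit_not1.
have -> : @digit_not1 R `&` S @^-1` B `&` `[0, 1[%classic =
    (S @^-1` B `&` cell 0) `|` (S @^-1` B `&` cell 2).
  rewrite -setIUr setIAC setIC; congr (_ `&` _).
  rewrite /cell /digit_not1; apply/seteqP; split=> x /=; rewrite !in_itv/=.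
    move=> [h1 /andP[h2 h3]]; have [h4|h4] := ltP x (1 / 3).
      by left; apply/andP; split; lra.
    right; apply/andP; split; last lra.
    rewrite leNgt; apply/negP => h5; apply: h1.
    by apply/andP; split; lra.
  move=> [] /andP[h1 h2]; split; try (by move=> /andP[? ?]; lra);
    by apply/andP; split; lra.
rewrite measureU; [|exact: measurableI|exact: measurableI|]; last first.
  rewrite /cell; apply/seteqP; split=> // x /=; rewrite !in_itv/=.
  by move=> [[_ /andP[_ h1]] [_ /andP[h2 _]]]; lra.
transitivity ((3^-1)%:E * mu B + (3^-1)%:E * mu B)%E.
  by congr (_ + _)%E; exact: lebesgue_cell.
rewrite -[mu B]fineK ?fin_num_measure// -!EFinM -EFinD; congr EFin; lra.
Qed.

Lemma unit_lebesgue_shift (B : set (measurableTypeR R)) : measurable B ->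
  mu (S @^-1` B) = mu B.
Proof.
move=> mB; have mSB := m_preimage mB.
rewrite -(setIT (S @^-1` B)) -(setUv (@digit_not1 R)) setIUr.
rewrite measureU; [| |  |]; last first.
- by rewrite setIACA setICr setI0.
- by apply: measurableI => //; apply: measurableC; exact: measurable_digit_not1.
- by apply: measurableI => //; exact: measurable_digit_not1.
rewrite [X in (mu X + _)%E]setIC unit_lebesgue_shift_digit//.
have E : mu (S @^-1` B `&` ~` @digit_not1 R) = ((3^-1)%:E * mu B)%E.
  rewrite unit_lebesgueE; last first.
    by apply: measurableI => //; apply: measurableC; exact: measurable_digit_not1.
  rewrite -(lebesgue_cell 1 mB) -setIA; congr (lebesgue_measure (_ `&` _)).
  rewrite /cell /digit_not1; apply/seteqP; split=> x /=; rewrite !in_itv/=.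
    by move=> [/contrapT /andP[? ?] _]; apply/andP; split; lra.
  move=> /andP[? ?]; split; last by apply/andP; split; lra.
  by apply; apply/andP; split; lra.
transitivity ((2 / 3)%:E * mu B + (3^-1)%:E * mu B)%E; first by congr (_ + _)%E.
rewrite -[mu B]fineK ?fin_num_measure// -!EFinM -EFinD; congr EFin; lra.
Qed.

End ternary_shift.

(** * Cantor stages and ternary digits *)

(** [cantor_index n a] holds when [a] has at most [n] ternary digits, none of
    them equal to [1]. *)
Fixpoint cantor_index (n a : nat) : bool :=
  if n is n'.+1 then cantor_index n' (a %/ 3) && (a %% 3 != 1)%N else a == 0%N.

(** Distinct intervals of the same stage are not adjacent. *)
Lemma cantor_indexS n a : cantor_index n a -> ~~ cantor_index n a.+1.
Proof.
elim: n a => [|n IH] a /=; first by [].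
move=> /andP[ga a1]; apply/negP => /andP[ga' a1'].
have e : (a.+1 %/ 3 = (a %/ 3).+1)%N by lia.
by rewrite e in ga'; move: (IH _ ga); rewrite ga'.
Qed.

Section stages.
Context (R : realType).
Implicit Types (x y : R) (n a : nat).

Let pow3_gt0 n : 0 < (3 : R) ^+ n. Proof. exact: exprn_gt0. Qed.

Let cellP n a x :
  `[(a%:R / 3 ^+ n : R), (a%:R + 1) / 3 ^+ n]%classic x <->
  a%:R <= 3 ^+ n * x <= a%:R + 1.
Proof. by rewrite /= in_itv/= ler_pdivrMr// ler_pdivlMr// mulrC. Qed.

Let stage n : set R :=
  [set x | exists a, cantor_index n a /\ a%:R <= 3 ^+ n * x <= a%:R + 1].

(** The gaps of length [3 ^- n] on both sides of an interval of the [n]-th stage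
    do not meet that stage. *)
Let stage_between n a x : cantor_index n a -> stage n x ->
  ~ (a%:R + 1 < 3 ^+ n * x < a%:R + 2) /\ ~ (a%:R - 1 < 3 ^+ n * x < a%:R).
Proof.
move=> ga [c [gc /andP[c1 c2]]]; split=> /andP[h1 h2].
  have e1 : (a < c.+1)%N by rewrite -(ltr_nat R) -natr1; lra.
  have e2 : (c < a.+2)%N.
    by rewrite -(ltr_nat R) -[a.+2%:R]natr1 -[a.+1%:R]natr1; lra.
  have e3 : (c != a) by apply/eqP => e; rewrite e in c2; lra.
  have e : c = a.+1 by lia.
  by move: (cantor_indexS ga); rewrite -e gc.
have e1 : (c < a)%N by rewrite -(ltr_nat R); lra.
have e2 : (a < c.+2)%N.
  by rewrite -(ltr_nat R) -[c.+2%:R]natr1 -[c.+1%:R]natr1; lra.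
have e : a = c.+1 by lia.
by move: (cantor_indexS gc); rewrite -e ga.
Qed.

Let component_stage n a x : cantor_index n a ->
  a%:R <= 3 ^+ n * x <= a%:R + 1 ->
  connected_component (stage n) x =
    `[(a%:R / 3 ^+ n : R), (a%:R + 1) / 3 ^+ n]%classic.
Proof.
move=> ga xa; apply/seteqP; split; last first.
  apply: connected_component_max; first exact/cellP.
    by move=> y /cellP ya; exists a.
  exact/connected_intervalP/interval_is_interval.
have sx : stage n x by exists a.
have int : is_interval (connected_component (stage n) x).
  exact/connected_intervalP/component_connected.
have cx : connected_component (stage n) x x by exact: connected_component_refl.
move=> y cy; apply/cellP; rewrite !leNgt; case/andP: xa => xa1 xa2.
have mulK z : 3 ^+ n * (z / 3 ^+ n) = z :> R by field; rewrite gt_eqF.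
apply/andP; split; apply/negP => hy.
(* A point [y] of the component to the left of the interval would bring with it
   a point [z / 3 ^+ n] of the gap that ends there. *)
- set z := (Num.max (3 ^+ n * y) (a%:R - 1) + a%:R) / 2.
  have /andP[z1 z2] : 3 ^+ n * y < z < a%:R.
    rewrite /z; case: (leP (3 ^+ n * y) (a%:R - 1)) => ?;
      by apply/andP; split; lra.
  have z3 : a%:R - 1 < z.
    by rewrite /z; case: (leP (3 ^+ n * y) (a%:R - 1)) => ?; lra.
  have : stage n (z / 3 ^+ n).
    apply: (@connected_component_sub _ (stage n) x); apply: (int y x) => //.
    rewrite ler_pdivlMr// ler_pdivrMr// ![_ * 3 ^+ n]mulrC.
    by apply/andP; split; lra.
  by move=> /(stage_between ga)[_]; apply; rewrite mulK z3 z2.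
(* The same on the right. *)
- set z := (Num.min (3 ^+ n * y) (a%:R + 2) + (a%:R + 1)) / 2.
  have /andP[z1 z2] : a%:R + 1 < z < 3 ^+ n * y.
    rewrite /z; case: (leP (3 ^+ n * y) (a%:R + 2)) => ?;
      by apply/andP; split; lra.
  have z3 : z < a%:R + 2.
    by rewrite /z; case: (leP (3 ^+ n * y) (a%:R + 2)) => ?; lra.
  have : stage n (z / 3 ^+ n).
    apply: (@connected_component_sub _ (stage n) x); apply: (int x y) => //.
    rewrite ler_pdivlMr// ler_pdivrMr// ![_ * 3 ^+ n]mulrC.
    by apply/andP; split; lra.
  by move=> /(stage_between ga)[+ _]; apply; rewrite mulK z3 z1.
Qed.

Let middle_stage n a x y : cantor_index n a ->
  a%:R <= 3 ^+ n * y <= a%:R + 1 ->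
  middle_third (connected_component (stage n) y) x <->
  3 * a%:R + 1 < 3 ^+ n.+1 * x < 3 * a%:R + 2.
Proof.
move=> ga ya; rewrite (component_stage ga ya) /middle_third.
have ale : a%:R / 3 ^+ n <= (a%:R + 1) / 3 ^+ n :> R.
  by rewrite ler_pM2r ?invr_gt0//; lra.
rewrite inf_itvcc// sup_itvcc//= in_itv/=.
have -> : a%:R / 3 ^+ n + ((a%:R + 1) / 3 ^+ n - a%:R / 3 ^+ n) / 3 =
    (3 * a%:R + 1) / 3 ^+ n.+1 :> R.
  by rewrite exprS; field; rewrite gt_eqF.
have -> : (a%:R + 1) / 3 ^+ n - ((a%:R + 1) / 3 ^+ n - a%:R / 3 ^+ n) / 3 =
    (3 * a%:R + 2) / 3 ^+ n.+1 :> R.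
  by rewrite exprS; field; rewrite gt_eqF.
by rewrite ltr_pdivrMr// ltr_pdivlMr// ![x * _]mulrC.
Qed.

(** The [n]-th stage is the union of the triadic intervals of rank [n] whose
    index has no ternary digit [1]. *)
Lemma cantor_stageP n : cantor_stage n =
  [set x : R | exists a, cantor_index n a /\ a%:R <= 3 ^+ n * x <= a%:R + 1].
Proof.
rewrite -/(stage n); elim: n => [|n IH] /=.
  apply/seteqP; split=> x /=; rewrite in_itv/=.
    by move=> h; exists 0%N; rewrite expr0 mul1r add0r.
  by move=> [a [/eqP-> ]]; rewrite expr0 mul1r add0r.
rewrite /remove_middle_thirds IH; apply/seteqP; split=> x /=.
  move=> [[a [ga xa]] nx].
  have [h|h] := leP (3 ^+ n.+1 * x) (3 * a%:R + 1).
    exists (3 * a)%N; split; first by rewrite /= mulKn// ga modnMr.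
    by rewrite natrM h andbT exprS; case/andP: xa => ? ?; lra.
  exists (3 * a + 2)%N; split.
    rewrite /=; have -> : ((3 * a + 2) %/ 3 = a)%N by lia.
    by rewrite ga; apply/eqP; lia.
  rewrite natrD natrM; apply/andP; split.
    rewrite leNgt; apply/negP => h'; apply: nx; exists x; first by exists a.
    by apply/(middle_stage x ga xa); rewrite h.
  by rewrite exprS; case/andP: xa => ? ?; lra.
(* A point of an interval of rank [n.+1] inside an open middle third would force
   the last digit of the index [b] to be [1]. *)
move=> [b [/andP[gb b1] /andP[xb1 xb2]]].
have eb : b%:R = 3 * (b %/ 3)%:R + (b %% 3)%:R :> R.
  by rewrite -natrM -natrD; congr (_%:R); lia.
have b3 : (b %% 3)%:R <= 2 :> R by rewrite ler_nat; lia.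
have b0 : 0 <= (b %% 3)%:R :> R by [].
split.
  exists (b %/ 3)%N; split=> //; rewrite exprS in xb1 xb2.
  by apply/andP; split; lra.
move=> [y [c [gc yc]]] /(middle_stage x gc yc) /andP[h1 h2].
have e1 : (3 * c + 1 < b.+1)%N.
  by rewrite -(ltr_nat R) -[b.+1%:R]natr1 natrD natrM; lra.
have e2 : (b < 3 * c + 2)%N by rewrite -(ltr_nat R) natrD natrM; lra.
by move/eqP: b1; apply; lia.
Qed.
End stages.

Lemma cantor_ladder_le (R : realType) (u : nat) (x : R) : 0 <= x <= 1 ->
  (cantor_ladder x <= u%:R%:E)%E <-> ~ cantor_stage u x.
Proof.
move=> x01; split.
  rewrite /cantor_ladder; case: pselect => [e|//]; case: cid => i /= [i1 [_ nx]].
  by rewrite lee_fin ler_nat => iu xu; apply: nx; exact: (cantor_stage_anti iu).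
elim: u => [|u IH] nx; first by exfalso; apply: nx; rewrite /= in_itv.
have [xu|/IH h] := pselect (cantor_stage u x).
  by rewrite (@cantor_ladder_gap _ u.+1)//.
by apply: (le_trans h); rewrite lee_fin ler_nat.
Qed.

Lemma mult_mod1_01 (R : realType) m (x : R) : 0 <= mult_mod1 m x < 1.
Proof.
have /andP[h1 h2] := floor_itv (m%:R * x).
by rewrite intrD in h2; rewrite /mult_mod1; apply/andP; split; lra.
Qed.

Lemma mult_mod1M (R : realType) a b (x : R) :
  mult_mod1 a (mult_mod1 b x) = mult_mod1 (a * b) x.
Proof.
rewrite /mult_mod1.
set z := Num.floor (b%:R * x).
have -> : a%:R * (b%:R * x - z%:~R) = (a * b)%:R * x + (- (a%:Z * z))%:~R.
  by rewrite natrM mulrNz intrM -pmulrn; ring.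
by rewrite floorDrz ?intr_int// intrKfloor intrD; ring.
Qed.

Lemma iter_mult_mod1 (R : realType) m n (x : R) : 0 <= x < 1 ->
  iter n (mult_mod1 m) x = mult_mod1 (m ^ n) x.
Proof.
move=> x01; elim: n => [|n /= ->]; last by rewrite mult_mod1M expnS.
rewrite /mult_mod1 expn0 mul1r (_ : Num.floor x = 0) ?subr0//.
by apply: floor_def; rewrite add0r.
Qed.

(** The triadic rationals. *)
Definition triadic (R : realType) : set R :=
  [set x | exists (n : nat) (z : int), 3 ^+ n * x = z%:~R].

Lemma countable_triadic (R : realType) : countable (@triadic R).
Proof.
apply: (@sub_countable _ _ _
    (range (fun c : nat * int => c.2%:~R / 3 ^+ c.1 : R))).
  apply: subset_card_le => x [n [z e]]; exists (n, z) => //=.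
  by rewrite -e; field; rewrite gt_eqF// exprn_gt0.
exact/(sub_countable (card_image_le _ _))/countableP.
Qed.

Lemma triadic_mult_mod1 (R : realType) k (x : R) :
  triadic (mult_mod1 (3 ^ k) x) -> triadic x.
Proof.
move=> [n [z e]]; exists (n + k)%N, (z + 3 ^+ n * Num.floor ((3 ^ k)%:R * x)).
rewrite intrD -e intrM /mult_mod1 natrX rmorphXn rmorph_nat exprD.
by ring.
Qed.

(** A non-triadic point of the unit interval lies in the [n]-th stage exactly
    when none of its first [n] ternary digits is [1]. *)
Lemma cantor_stage_run (R : realType) n (x : R) : 0 <= x < 1 -> ~ triadic x ->
  cantor_stage n x <-> run (mult_mod1 3) (@digit_not1 R) n x.
Proof.
move=> x01 nx; have p3 i : 0 < 3 ^+ i :> R by exact: exprn_gt0.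
have y0 i : 0 <= 3 ^+ i * x by case/andP: x01 => ? ?; rewrite mulr_ge0// ltW.
have -> : cantor_stage n x <-> cantor_index n (Num.truncn (3 ^+ n * x)).
  rewrite cantor_stageP; split=> [[a [ga /andP[a1 a2]]]|].
    rewrite (_ : Num.truncn _ = a)//; apply: truncn_def.
    rewrite a1 /= -[a.+1%:R]natr1 lt_neqAle a2 andbT; apply/eqP => e.
    by apply: nx; exists n, a.+1; rewrite e -pmulrn natr1.
  move=> gt; exists (Num.truncn (3 ^+ n * x)); split=> //.
  by have /andP[-> ] := truncn_itv (y0 n); rewrite natr1 => /ltW.
elim: n => [|n IH].
  rewrite /= expr0 mul1r (_ : Num.truncn x = 0%N)//.
  by apply: truncn_def.
have -> : run (mult_mod1 3) (@digit_not1 R) n.+1 x <->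
    run (mult_mod1 3) (@digit_not1 R) n x /\ digit_not1 (iter n (mult_mod1 3) x).
  split=> [h|[h h'] i].
    by split=> [i iu|]; apply: h => //; exact: ltnW.
  by rewrite ltnS leq_eqVlt => /orP[/eqP->//|]; exact: h.
rewrite -IH iter_mult_mod1//.
set t := Num.truncn (3 ^+ n * x).
have /andP[t1 t2] := truncn_itv (y0 n); rewrite -/t -[t.+1%:R]natr1 in t1 t2.
have -> : mult_mod1 (3 ^ n) x = 3 ^+ n * x - t%:R.
  rewrite /mult_mod1 natrX (@floor_def _ _ t%:Z)//.
  by rewrite intrD -!pmulrn t1.
set y := 3 ^+ n * x - t%:R.
have yx : 3 ^+ n.+1 * x = 3 * t%:R + 3 * y by rewrite exprS /y; ring.
have yy : 0 <= y < 1 by rewrite /y; apply/andP; split; lra.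
pose r := Num.truncn (3 * y).
have /andP[r1 r2] : r%:R <= 3 * y < r.+1%:R.
  by apply: truncn_itv; case/andP: yy => ? ?; lra.
have r3 : (r < 3)%N by rewrite -(ltr_nat R); case/andP: yy => ? ?; lra.
have -> : Num.truncn (3 ^+ n.+1 * x) = (3 * t + r)%N.
  apply: truncn_def; rewrite yx -[(3 * t + r).+1%:R]natr1 natrD natrM.
  rewrite -[r.+1%:R]natr1 in r2.
  by apply/andP; split; lra.
rewrite /= (_ : (3 * t + r) %/ 3 = t)%N; last by lia.
rewrite (_ : (3 * t + r) %% 3 = r)%N; last by lia.
rewrite /digit_not1 /=; split.
  move=> /andP[-> /eqP rn1]; split=> // /andP[h1 h2]; apply: rn1.
  have e1 : (0 < r)%N by rewrite -ltnS -(ltr_nat R); lra.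
  have e2 : (r < 2)%N by rewrite -(ltr_nat R); lra.
  by lia.
move=> [-> /= h]; apply/eqP => e; apply: h; rewrite e in r1 r2.
by apply/andP; split; lra.
Qed.

(** * The maximum of the Cantor ladder function along an orbit *)

Section transfer.
Context (R : realType).

(** Two sets which agree on the non-triadic points of the unit interval have
    the same measure, even if only the second is known to be measurable. *)
Lemma leb01_eq (E : set R) (F : set (measurableTypeR R)) : measurable F ->
  (forall x, 0 <= x < 1 -> ~ triadic x -> E x <-> F x) ->
  leb01 E = unit_lebesgue F.
Proof.
move=> mF EF.
pose I : set (measurableTypeR R) := `[(0 : R), 1]%classic.
pose Z : set (measurableTypeR R) := @triadic R.
have countable_measurableR (A : set (measurableTypeR R)) :
    countable A -> measurable A.
  by apply: countable_measurable => t; exact: measurable_set1.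
have cZ (A : set (measurableTypeR R)) : countable (A `&` Z).
  apply: sub_countable (countable_triadic R).
  by apply: subset_card_le; exact: subIsetr.
have decomp (A : set (measurableTypeR R)) : measurable (A `&` I `&` ~` Z) ->
    lebesgue_measure (A `&` I) = lebesgue_measure (A `&` I `&` ~` Z).
  move=> mA; rewrite -[in LHS](setIT (A `&` I)) -(setvU Z) setIUr.
  rewrite measureU0//; first exact: countable_measurableR (cZ _).
  exact: countable_lebesgue_measure0 (cZ _).
have mF' : measurable (F `&` I `&` ~` Z).
  apply: measurableI; first by apply: measurableI => //; exact: measurable_itv.
  by apply: measurableC; rewrite -(setTI Z); exact: countable_measurableR (cZ _).
have EF' : E `&` I `&` ~` Z = F `&` I `&` ~` Z.
  have x1 (x : R) : I x -> ~ Z x -> 0 <= x < 1.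
    rewrite /I/= in_itv/= => /andP[-> x1] nZ/=; rewrite lt_neqAle x1 andbT.
    (* the endpoint [1] is triadic *)
    by apply/eqP => e; apply: nZ; exists 0%N, 1; rewrite e mulr1.
  apply/seteqP; split=> x [[Ax Ix] nZ]; split=> //; split=> //;
    by apply/(EF x) => //; exact: x1.
have mE' : measurable (E `&` I `&` ~` Z) by rewrite EF'.
rewrite /unit_lebesgue /leb01 /mrestr.
transitivity (lebesgue_measure (F `&` I `&` ~` Z)).
  by rewrite -EF'; exact: decomp.
by rewrite decomp.
Qed.

Lemma leb01_cantor_ladder_gt (u : nat) :
  leb01 [set x : R | (u%:R%:E < cantor_ladder x)%E] = ((2 / 3) ^+ u)%:E.
Proof.
have H := probability_run (@measurable_mult_mod1 R 3) (@measurable_digit_not1 R)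
  (@unit_lebesgue_shift_digit R) u.
rewrite -H; apply: leb01_eq.
  exact: measurable_run (@measurable_mult_mod1 R 3)
    (@measurable_digit_not1 R) u.
move=> x x01 nx; apply: (iff_trans _ (cantor_stage_run u x01 nx)).
have x01' : 0 <= x <= 1 by case/andP: x01 => -> /ltW ->.
rewrite /= ltNge; split=> [/negP h|h].
  by apply: contrapT => /(cantor_ladder_le u x01').
by apply/negP => /(cantor_ladder_le u x01').
Qed.

Lemma leb01_partial_max_le (k u N : nat) :
  leb01 [set x : R | (partial_max (fun j x =>
     cantor_ladder (iter j (mult_mod1 (3 ^ k)) x)) N x <= u%:R%:E)%E] =
  unit_lebesgue (run_free (mult_mod1 3) (@digit_not1 R) k u N).
Proof.
apply: leb01_eq.
  exact: measurable_run_free (@measurable_mult_mod1 R 3)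
    (@measurable_digit_not1 R) k u N.
move=> x x01 nx; rewrite /partial_max /run_free /=.
have iterE j : iter j (mult_mod1 (3 ^ k)) x = iter (j * k) (mult_mod1 3) x.
  by rewrite !iter_mult_mod1// -expnM mulnC.
have key j : (cantor_ladder (iter j (mult_mod1 (3 ^ k)) x) <= u%:R%:E)%E <->
    ~ run (mult_mod1 3) (@digit_not1 R) u (iter (j * k) (mult_mod1 3) x).
  rewrite iterE iter_mult_mod1//; set y := mult_mod1 _ x.
  have y01 : 0 <= y < 1 by exact: mult_mod1_01.
  have ny : ~ triadic y by move=> /triadic_mult_mod1.
  rewrite -(cantor_stage_run u y01 ny).
  by apply: cantor_ladder_le; case/andP: y01 => -> /ltW ->.
split=> [/bigmax_leP[_ h] j jN|h].
  by apply/key; exact: (h (Ordinal jN)).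
by apply/bigmax_leP; split=> [|j _]; [rewrite leNye|apply/key/h].
Qed.

End transfer.

(** * Limits *)

Section limits.
Context (R : realType).

Lemma cvg_mul_geometric23 : n%:R * (2 / 3 : R) ^+ n @[n --> \oo] --> 0.
Proof.
(* Bernoulli's inequality for [5 / 4], whose product with [2 / 3] is still below
   [1]. *)
have bern n : n%:R <= 4 * (5 / 4 : R) ^+ n.
  suff : 4 + n%:R <= 4 * (5 / 4 : R) ^+ n by lra.
  elim: n => [|n IH]; first by rewrite expr0; lra.
  rewrite exprS -[n.+1%:R]natr1; have : 0 <= n%:R :> R by []; lra.
apply: (@squeeze_cvgr _ _ _ _ (fun=> 0) (fun n => 4 * (5 / 6 : R) ^+ n)).
- apply: nearW => n; rewrite mulr_ge0 ?exprn_ge0//=.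
  rewrite (_ : 5 / 6 = (5 / 4) * (2 / 3)); last by lra.
  by rewrite [in leRHS]exprMn mulrA ler_wpM2r// exprn_ge0.
- exact: cvg_cst.
- rewrite -[X in _ --> X](mulr0 4); apply: cvgM; first exact: cvg_cst.
  by apply: cvg_expr; rewrite ger0_norm; lra.
Qed.

(** The limit of [(1 - e_n) ^ w_n] when [e_n] tends to [0] and [w_n * e_n] to
    [l]. *)
Lemma cvg_onem_expn (e : R ^nat) (w : nat -> nat) (l : R) :
  (forall n, 0 <= e n < 1) -> e n @[n --> \oo] --> 0 ->
  (w n)%:R * e n @[n --> \oo] --> l ->
  (1 - e n) ^+ w n @[n --> \oo] --> expR (- l).
Proof.
move=> e01 e0 wl.
apply: (@squeeze_cvgr _ _ _ _
  (fun n => expR (- ((w n)%:R * e n / (1 - e n))))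
  (fun n => expR (- ((w n)%:R * e n)))).
- apply: nearW => n; have /andP[en0 en1] := e01 n.
  rewrite -mulrA -[- (_ * (_ / _))]mulrN -[- (_ * e n)]mulrN !expRM_natl.
  apply/andP; split.
    apply: lerXn2r; rewrite ?nnegrE ?expR_ge0 ?subr_ge0 ?(ltW en1)//.
    (* [(1 - e)^-1 = 1 + e / (1 - e) <= expR (e / (1 - e))] *)
    rewrite expRN -[leRHS]invrK lef_pV2 ?posrE ?expR_gt0 ?invr_gt0 ?subr_gt0//.
    apply: le_trans (expR_ge1Dx _).
    rewrite (_ : 1 + e n / (1 - e n) = (1 - e n)^-1)//.
    by field; rewrite subr_eq0 gt_eqF.
  apply: lerXn2r; rewrite ?nnegrE ?expR_ge0 ?subr_ge0 ?(ltW en1)//.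
  exact: expR_ge1Dx.
- have wl1 : (w n)%:R * e n / (1 - e n) @[n --> \oo] --> l / (1 - 0).
    apply: cvgM => //; apply: cvgV; first by rewrite subr0 oner_eq0.
    by apply: cvgB => //; exact: cvg_cst.
  rewrite subr0 divr1 in wl1.
  by apply: (continuous_cvg _ (@continuous_expR R _)); exact: cvgN.
- by apply: (continuous_cvg _ (@continuous_expR R _)); exact: cvgN.
Qed.

Variables (tau : R) (tau_ge0 : 0 <= tau).

(** The number of observations at level [u]: both sequences of the theorem are
    functions of [u] alone. *)
Let w (u : nat) : nat := Num.truncn (tau * (3 / 2) ^+ u).

Let w_delta_bound u :
  tau - (2 / 3) ^+ u <= (w u)%:R * (2 / 3) ^+ u <= tau.
Proof.
have d0 : 0 < (2 / 3 : R) ^+ u by apply: exprn_gt0; lra.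
have d1 : (3 / 2 : R) ^+ u * (2 / 3) ^+ u = 1.
  by rewrite -exprMn (_ : 3 / 2 * (2 / 3) = 1) ?expr1n//; field.
have /andP[h1 h2] : (w u)%:R <= tau * (3 / 2) ^+ u < (w u).+1%:R.
  by apply: truncn_itv; rewrite mulr_ge0// exprn_ge0//; lra.
have e : tau = tau * (3 / 2) ^+ u * (2 / 3) ^+ u by rewrite -mulrA d1 mulr1.
rewrite -[(w u).+1%:R]natr1 in h2; apply/andP; split; last first.
  by rewrite [leRHS]e ler_wpM2r// ltW.
by rewrite [X in X - _]e lerBlDr -[X in _ + X]mul1r -mulrDl ler_wpM2r// ltW.
Qed.

Lemma cvg_window : (w u)%:R * (2 / 3) ^+ u @[u --> \oo] --> tau.
Proof.
apply: (@squeeze_cvgr _ _ _ _ (fun u => tau - (2 / 3) ^+ u) (fun=> tau)).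
- by apply: nearW => u; exact: w_delta_bound.
- rewrite -[X in _ --> X]subr0; apply: cvgB; first exact: cvg_cst.
  by apply: cvg_expr; rewrite ger0_norm; lra.
- exact: cvg_cst.
Qed.

Lemma cvg_free (k : nat) : (0 < k)%N ->
  fine (unit_lebesgue (run_free (mult_mod1 3) (@digit_not1 R) k u (w u)))
    @[u --> \oo] --> expR (- (1 - 2 ^+ k / 3 ^+ k) * tau).
Proof.
move=> k0; set p := fun u : nat => fine _; pose c : R := 1 - (2 / 3) ^+ k.
have c01 : 0 <= c < 1.
  rewrite /c gtrBl exprn_gt0 ?andbT ?subr_ge0; last by lra.
  by apply: exprn_ile1; lra.
pose d u : R := (2 / 3) ^+ u.
have d0 u : 0 <= d u by apply: exprn_ge0; lra.
have d1 u : d u <= 1 by apply: exprn_ile1; lra.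
have dcvg : d u @[u --> \oo] --> 0 by apply: cvg_expr; rewrite ger0_norm; lra.
have powcvg : (1 - d u * c) ^+ w u @[u --> \oo] --> expR (- (tau * c)).
  apply: cvg_onem_expn.
  - move=> u; case/andP: c01 => c0 c1; rewrite mulr_ge0//=.
    by apply: le_lt_trans c1; rewrite ler_piMl.
  - by rewrite -(mul0r c); apply: cvgM => //; exact: cvg_cst.
  - under eq_fun do rewrite mulrA.
    by apply: cvgM; [exact: cvg_window|exact: cvg_cst].
have err : d u + tau * (u%:R * d u) @[u --> \oo] --> 0.
  rewrite -[X in _ --> X]addr0 -[X in _ --> _ + X](mulr0 tau); apply: cvgD => //.
  by apply: cvgM; [exact: cvg_cst|exact: cvg_mul_geometric23].
have bound u : `|p u - (1 - d u * c) ^+ w u| <= d u + tau * (u%:R * d u).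
  have := probability_run_free (@measurable_mult_mod1 R 3) (@measurable_digit_not1 R)
    (@unit_lebesgue_shift R) (@unit_lebesgue_shift_digit R) u k0 (w u).
  move=> /le_trans; apply; rewrite lerD2l.
  have /andP[_ h] := w_delta_bound u.
  rewrite (_ : _ * _ = (w u)%:R * d u * (u%:R * d u)); last by rewrite /d; ring.
  by rewrite ler_wpM2r// mulr_ge0.
have -> : - (1 - 2 ^+ k / 3 ^+ k) * tau = - (tau * c).
  by rewrite /c expr_div_n; ring.
apply: (@squeeze_cvgr _ _ _ _
  (fun u => (1 - d u * c) ^+ w u - (d u + tau * (u%:R * d u)))
  (fun u => (1 - d u * c) ^+ w u + (d u + tau * (u%:R * d u)))).
- apply: nearW => u; move: (bound u); rewrite ler_norml => /andP[? ?].
  by apply/andP; split; lra.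
- by rewrite -[X in _ --> X]subr0; exact: cvgB.
- by rewrite -[X in _ --> X]addr0; exact: cvgD.
Qed.

End limits.

Theorem theorem3p3 (R : realType) (k : nat) (tau : R) :
  (1 <= k)%N -> 0 <= tau ->
  let m := (3 ^ k)%N in
  let T : R -> R := mult_mod1 m in
  let mu : set R -> \bar R := @leb01 R in
  let X (j : nat) (x : R) : \bar R := cantor_ladder (iter j T x) in
  let M (N : nat) (x : R) : \bar R := partial_max X N x in
  let u (n : nat) : nat := (n + k - 1)%N in
  let w (n : nat) : nat := Num.truncn (tau * (3 / 2) ^+ (n + k - 1)) in
  ((w n)%:R%:E * mu [set x | (u n)%:R%:E < X 0%N x])%E @[n --> \oo] --> tau%:E
  /\
  mu [set x | (M (w n) x <= (u n)%:R%:E)%E] @[n --> \oo] -->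
    (expR (- (1 - 2 ^+ k / 3 ^+ k) * tau))%:E.
Proof.
move=> k1 tau0 m T mu X M u w.
have shift (f : R ^nat) (l : R) : f n @[n --> \oo] --> l ->
    f (u n) @[n --> \oo] --> l.
  rewrite -(cvg_shiftn k.-1 f) => fl.
  rewrite (_ : (fun n => f (u n)) = [sequence f (n + k.-1)%N]_n)//.
  by apply/funext => n /=; congr f; rewrite /u; lia.
split.
- rewrite /mu /X/=; under eq_fun do rewrite leb01_cantor_ladder_gt -EFinM.
  apply: cvg_EFin; first exact: nearW.
  exact: (shift _ _ (cvg_window tau0)).
- have E n : mu [set x | (M (w n) x <= (u n)%:R%:E)%E] =
      (fine (unit_lebesgue (run_free (mult_mod1 3) (@digit_not1 R) k (u n) (w n))))%:E.
    rewrite /mu /M leb01_partial_max_le fineK// fin_num_measure//.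
    exact: measurable_run_free (@measurable_mult_mod1 R 3)
      (@measurable_digit_not1 R) k (u n) (w n).
  under eq_fun do rewrite E.
  apply: cvg_EFin; first exact: nearW.
  exact: (shift _ _ (cvg_free tau0 k1)).
Qed.
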